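(* For any integer $k \ge 2$, the equation $n/Z(n) = k$ has infinitely many solutions in positive integers $n$.
   Context: For a positive integer $m$ let $T(m) = m(m+1)/2$ denote the $m$-th triangular number. The pseudo-Smarandache function is defined for positive integers $n$ by $Z(n) = \min\{ m \ge 1 : n \mid T(m) \}$. *)

(* Defs.v *)
From mathcomp Require Import all_boot.

Set Implicit Arguments.
Unset Strict Implicit.
Unset Printing Implicit Defensive.

Definition triangular (m : nat) : nat := (m * m.+1) %/ 2.

Lemma triangular_multiple_exists (n : nat) :
  exists m, (1 <= m) && (n.+1 %| triangular m).
Proof.
exists n.*2.+1; rewrite /triangular -doubleS -[n.+1.*2]muln2 mulnA mulnK //.
exact: dvdn_mull.
Qed.

(* No positive m satisfies 0 %| triangular m; the value 0 at n = 0 is a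
   convention outside the domain of the function. *)
Definition pseudo_smarandache (n : nat) : nat :=
  if n is n'.+1 then ex_minn (triangular_multiple_exists n') else 0.

(* Main.v *)
(** If [q] is a prime power with [q = -1 mod 2k], then [Z(k q) = q]: the
    only [0 < m < q] with [q] dividing [m (m + 1)] is [q - 1], and [2k] cannot
    divide both [q + 1] and [q - 1].  Odd powers of a prime [p = -1 mod 2k] give infinitely
    many such [q], so a single prime [p = -1 mod N] with [2k] dividing [N = 12k]
    suffices.

    Such a prime comes from the integer [V(s, t)] obtained by homogenizing the
    [N]-th cyclotomic polynomial and evaluating it at [(t + s i, t - s i)].  When
    [N] divides [s] and [t] is coprime to [N], [V] is coprime to [N] and, since
    [4] divides [N], congruent to [Phi_N(1) = +-1] modulo [4]; as [V] has simple real roots in [s / t], its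
    sign can be prescribed so that [|V| = 3 mod 4].  Hence some prime
    [p = 3 mod 4] divides [V].  In characteristic [p] the Frobenius map swaps
    [t + s i] and [t - s i], so their quotient is a primitive [N]-th root of
    unity of order dividing [p + 1]. *)

Require Import Defs.
From mathcomp Require Import all_boot all_algebra.
From mathcomp Require Import classical_sets cardinality.
From mathcomp Require Import all_order all_field zify ring.

Set Implicit Arguments.
Unset Strict Implicit.
Unset Printing Implicit Defensive.

Import Order.TTheory GRing.Theory Num.Theory.

(** * Values of the pseudo-Smarandache function at multiples of prime powers *)

Lemma triangular_double m : (triangular m).*2 = m * m.+1.
Proof.
by rewrite /triangular -muln2 divnK // dvdn2 oddM /= andbN.
Qed.

Lemma pseudo_smarandacheP n m : 0 < n -> 0 < m -> n %| triangular m ->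
  (forall m', 0 < m' -> n %| triangular m' -> m <= m') ->
  pseudo_smarandache n = m.
Proof.
case: n => // n _ m_gt0 dv_m min_m; rewrite /pseudo_smarandache.
case: ex_minnP => m' /andP[m'_gt0 dv_m'] min_m'; apply/eqP.
by rewrite eqn_leq min_m ?min_m' ?m_gt0.
Qed.

Lemma pseudo_smarandache_prime_power k p a :
  1 < k -> prime p -> 0 < a -> k.*2 %| (p ^ a).+1 ->
  pseudo_smarandache (k * p ^ a) = p ^ a.
Proof.
move=> k_gt1 p_pr a_gt0 dv_2k; set q := p ^ a in dv_2k *.
have q_gt0 : 0 < q by rewrite expn_gt0 prime_gt0.
have dvT m : (k * q %| triangular m) = (k.*2 * q %| m * m.+1).
  by rewrite -triangular_double -!muln2 mulnAC dvdn_pmul2r.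
have co_kq : coprime k.*2 q.
  by rewrite (coprime_dvdl dv_2k) // coprimeSn.
apply: pseudo_smarandacheP => //; first by rewrite muln_gt0 q_gt0 (ltnW k_gt1).
  by rewrite dvT mulnC dvdn_mul.
move=> m m_gt0; rewrite dvT Gauss_dvd // => /andP[dvk dvq].
have co_m : coprime m m.+1 by rewrite coprimenS.
rewrite -ltnS in dvq *.
(* As [m] and [m.+1] are coprime, the prime power [q] divides one of them entirely; if it divides
   [m], the bound is immediate. *)
have [p_m1 | p'm1] := boolP (p %| m.+1); last first.
  move: dvq; rewrite Gauss_dvdl ?coprime_pexpl ?prime_coprime // => dvq.
  by rewrite ltnS dvdn_leq.
have p'm : coprime q m.
  rewrite coprime_pexpl // coprime_sym.
  exact: coprime_dvdr p_m1 co_m.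
move: dvq; rewrite Gauss_dvdr // => dvq.
rewrite ltn_neqAle dvdn_leq // andbT; apply/eqP => q_m1.
have dv_m : k.*2 %| m by rewrite -(Gauss_dvdl m co_kq) q_m1.
move: dv_2k; rewrite q_m1 -addn2 dvdn_addr // => /dvdn_leq-/(_ isT).
by rewrite (leq_double _ 1) leqNgt k_gt1.
Qed.

(** If the least prime divisor is not 3 modulo 4, it is 1 modulo 4 because [n] is odd, and the
    smaller cofactor is again 3 modulo 4. *)
Lemma modn4_prime_divisor n : n %% 4 = 3 -> exists2 p, p %| n & prime p && (p %% 4 == 3).
Proof.
elim/ltn_ind: n => n IH n3.
have n_gt1 : 1 < n by case: n n3 {IH} => [|[|]].
have p_pr := pdiv_prime n_gt1; have p_n := pdiv_dvd n.
set p := pdiv n in p_pr p_n; have [p3|p3] := eqVneq (p %% 4) 3.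
  by exists p => //; rewrite p_pr p3.
have /dvdnP[m Dn] := p_n.
have m3 : m %% 4 = 3.
  have oddp : p %% 4 = 1.
    have : p * m %% 4 = 3 by rewrite mulnC -Dn.
    rewrite -modnMm; have := ltn_pmod p (isT : 0 < 4); have := ltn_pmod m (isT : 0 < 4).
    by move: p3; case: (p %% 4) => [|[|[|[|]]]] //; case: (m %% 4) => [|[|[|[|]]]].
  by move: n3; rewrite Dn -modnMm oddp muln1 modn_mod.
have [|r r_m r_ok] := IH m _ m3.
  by rewrite Dn ltn_Pmulr ?prime_gt1 //; case: (m) m3.
by exists r => //; rewrite Dn dvdn_mulr.
Qed.

(** * Homogenized integer polynomials at conjugate Gaussian arguments *)

Local Open Scope ring_scope.

(** The homogenization of [P] in degree [(size P).-1]. The ring is left arbitrary so that one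
    integer form can be evaluated in [{poly int}], in [algC] and in characteristic [p]. *)
Definition hform (P : {poly int}) (R : comNzRingType) (a b : R) : R :=
  \sum_(j < size P) (P`_j)%:~R * a ^+ j * b ^+ ((size P).-1 - j).

Arguments hform P {R} a b.

Lemma rmorph_hform (R S : comNzRingType) (f : {rmorphism R -> S}) P a b :
  f (hform P a b) = hform P (f a) (f b).
Proof.
rewrite /hform rmorph_sum; apply: eq_bigr => j _.
by rewrite !rmorphM !rmorphXn rmorph_int.
Qed.

Lemma hform_horner (F : fieldType) P (a b : F) : b != 0 ->
  hform P a b = b ^+ (size P).-1 * (map_poly intr P).[a / b].
Proof.
move=> nz_b; rewrite (@horner_coef_wide _ (size P)) ?size_poly //.
rewrite mulr_sumr; apply: eq_bigr => j _.
have le_j : (j <= (size P).-1)%N by rewrite -ltnS (leq_trans (ltn_ord j)) ?leqSpred.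
rewrite coef_map -[in RHS](subnK le_j) exprD expr_div_n.
have nz_bj : b ^+ j != 0 by rewrite expf_neq0.
by field.
Qed.

Lemma hform_monic0 (R : comNzRingType) P (a : R) : P \is monic ->
  hform P a 0 = a ^+ (size P).-1.
Proof.
move=> monP; have := size_poly_eq0 P; rewrite (negPf (monic_neq0 monP)).
move/monicP: monP; rewrite /lead_coef /hform; case: (size P) => // n /= lP _.
rewrite big_ord_recr /= lP subnn mul1r mulr1 big1 ?add0r // => j _.
by rewrite expr0n subn_eq0 leqNgt ltn_ord mulr0.
Qed.

(** Both arguments are [t] modulo [s], so each monomial is its coefficient times the same power of
    [t], and the coefficients add up to [P.[1]]. *)
Lemma hform_cong (R : comNzRingType) P (s t a b : R) :
  exists w, hform P (t + s * a) (t + s * b)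
            = (P.[1])%:~R * t ^+ (size P).-1 + s * w.
Proof.
have congX (c : R) j : exists w, (t + s * c) ^+ j = t ^+ j + s * w.
  elim: j => [|j [w IH]]; first by exists 0; rewrite mulr0 addr0.
  by exists (t * w + c * t ^+ j + s * c * w); rewrite !exprS IH; ring.
rewrite horner_coef (big_morph (fun x : int => x%:~R : R) (intrD R) (mulr0z 1)) mulr_suml /hform.
apply: (big_ind2 (fun x y => exists w, x = y + s * w)) => [|x1 y1 x2 y2 [w1 ->] [w2 ->]|j _].
- by exists 0; rewrite mulr0 addr0.
- by exists (w1 + w2); ring.
have le_j : (j <= (size P).-1)%N by rewrite -ltnS (leq_trans (ltn_ord j)) ?leqSpred.
have [w1 ->] := congX a j; have [w2 ->] := congX b ((size P).-1 - j)%N.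
have -> : t ^+ (size P).-1 = t ^+ j * t ^+ ((size P).-1 - j).
  by rewrite -exprD subnKC.
rewrite expr1n mulr1.
by exists ((P`_j)%:~R * (t ^+ j * w2 + w1 * t ^+ ((size P).-1 - j) + s * w1 * w2)); ring.
Qed.

(** [A + B * 'X] is the remainder of [W] modulo ['X^2 + 1], computed by Horner's scheme before any
    ring is chosen: multiplying by [i] sends [(A, B)] to [(- B, A)]. *)
Lemma horner_gauss (W : {poly int}) : exists A B : int,
  forall (R : comNzRingType) (i : R), i ^+ 2 = -1 ->
  (map_poly intr W).[i] = A%:~R + B%:~R * i.
Proof.
elim/poly_ind: W => [|W c [A [B IH]]].
  by exists 0, 0 => R i _; rewrite rmorph0 horner0 mul0r addr0.
exists (c - B), A => R i i2.
rewrite rmorphD rmorphM /= map_polyX map_polyC /= hornerMXaddC (IH R i i2).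
by rewrite mulrDl -mulrA -expr2 i2; ring.
Qed.

(* [A] and [B] are obtained once in [Z[X]], so that the same integers serve both
   over [algC], for the sign, and in characteristic [p]. *)
Lemma hform_gauss (P : {poly int}) (s t : int) : exists A B : int,
  forall (R : comNzRingType) (i : R), i ^+ 2 = -1 ->
  hform P (t%:~R + s%:~R * i) (t%:~R - s%:~R * i) =
  (P.[1] * t ^+ (size P).-1 + s * A)%:~R + (s * B)%:~R * i.
Proof.
have [w Dw] := hform_cong P (s%:P) (t%:P) 'X (- 'X).
have [A [B gAB]] := horner_gauss w; exists A, B => R i i2.
have ciR : commr_rmorph intr i by move=> c; exact: mulrC.
pose ev : {rmorphism {poly int} -> R} := horner_morph ciR.
have evC c : ev c%:P = c%:~R by rewrite /ev /= horner_morphC.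
have evX : ev 'X = i by rewrite /ev /= horner_morphX.
have := congr1 ev Dw.
rewrite rmorph_hform !(rmorphD, rmorphM, rmorphN, rmorphXn, rmorph_int) !evC evX.
rewrite [ev w](gAB R i i2) mulrN => ->.
by ring.
Qed.

(** * Parity of the totient and cyclotomic values at 1 *)

(** Makes [t ^ totient N] a square, hence 1 modulo 4 for odd [t]. The 2-part of [n] is at least 4,
    so its totient is already even. *)
Lemma totient_even n : (4 %| n)%N -> (0 < n)%N -> ~~ odd (totient n).
Proof.
move=> dv4 n_gt0; rewrite -(partnC 2%N n_gt0) totient_coprime ?coprime_partC //.
have : (1 < logn 2%N n)%N by rewrite -(pfactor_dvdn 2%N).
rewrite p_part; case: (logn 2%N n) => [|[|l]] // _.
by rewrite oddM totient_pfactor // oddM oddX.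
Qed.

(* ['Phi_(u * v)] divides [('X^(u * v) - 1) / ('X^u - 1)], whose value at [1] is [v]. *)
Lemma Cyclotomic_mul_horner1_dvd u v : coprime u v -> (1 < u)%N -> (1 < v)%N ->
  (('Phi_(u * v)).[1] %| v%:Z)%Z.
Proof.
move=> co_uv u_gt1 v_gt1.
have [u_gt0 v_gt0] := (ltnW u_gt1, ltnW v_gt1).
have n_gt0 : (0 < u * v)%N by rewrite muln_gt0 u_gt0.
pose n := (u * v)%N.
have nz_u : ('X^u - 1 : {poly int}) != 0.
  by rewrite -size_poly_eq0 size_XnsubC.
have : \prod_(d <- divisors n) 'Phi_d
  = \prod_(d <- divisors u) 'Phi_d * \prod_(d <- divisors n | ~~ (d %| u)%N) 'Phi_d.
  rewrite (bigID (fun d => d %| u)%N) /=; congr (_ * _).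
  rewrite -big_filter; apply: perm_big; apply: uniq_perm => [||d].
  - by rewrite filter_uniq ?divisors_uniq.
  - exact: divisors_uniq.
  rewrite mem_filter -!dvdn_divisors //.
  by apply: andb_idr => dv_u; apply: dvdn_mulr.
rewrite !prod_Cyclotomic // /n exprM -[X in _ - X](expr1n _ v) subrXX.
move=> /(mulfI nz_u) /(congr1 (horner^~ 1)).
rewrite (big_rem n) /=; last by rewrite -dvdn_divisors.
have -> /= : ~~ (n %| u)%N.
  by rewrite gtnNdvd // /n -{1}[u]muln1 ltn_pmul2l.
rewrite hornerM horner_sum.
rewrite (eq_bigr (fun=> 1)) => [|i _]; last first.
  by rewrite expr1n mulr1 -exprM hornerXn expr1n.
rewrite sumr_const card_ord natz => ->.
by rewrite dvdz_mulr.
Qed.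

(** By symmetry the value divides both [u] and [v], which are coprime. *)
Lemma Cyclotomic_coprime_horner1 u v : coprime u v -> (1 < u)%N -> (1 < v)%N ->
  exists b : bool, ('Phi_(u * v)).[1] = (-1) ^+ b :> int.
Proof.
move=> co_uv u_gt1 v_gt1.
have dv := Cyclotomic_mul_horner1_dvd co_uv u_gt1 v_gt1.
have du : (('Phi_(u * v)).[1] %| u%:Z)%Z.
  by rewrite mulnC Cyclotomic_mul_horner1_dvd // coprime_sym.
have : (`|('Phi_(u * v)).[1]| %| gcdn u v)%N by rewrite dvdn_gcd; apply/andP.
by rewrite (eqnP co_uv) dvdn1; case: (_.[1]) => [[|[|]]|[|]] //= _; [exists false | exists true].
Qed.

(** * Prescribing a sign near a simple real root *)

Lemma real_rational_approx (N : nat) (r d : algC) : (0 < N)%N -> r \is Num.real -> 0 < d ->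
  exists (s1 s2 : int) (t : nat), [/\ (0 < t)%N, coprime t N,
   r - d < (N%:Z * s1)%:~R / t%:R < r & r < (N%:Z * s2)%:~R / t%:R < r + d].
Proof.
move=> N_gt0 r_real d_gt0.
pose D := 2 * N%:R / d.
have D_gt0 : 0 <= D by rewrite divr_ge0 ?mulr_ge0 ?ler0n // ltW.
(* Being 1 modulo [N], [t] is coprime to [N]; exceeding [D], it makes two steps of the grid of
   multiples of [N / t] shorter than [d]. *)
pose t := (Num.bound D * N).+1.
have nN : 0 < N%:R :> algC by rewrite ltr0n.
have t_gt0 : 0 < t%:R :> algC by rewrite ltr0n.
have Dt : D < t%:R.
  apply: lt_le_trans (archi_boundP D_gt0) _.
  by rewrite ler_nat ltnW // ltnS leq_pmulr.
have lt_dt : 2 * N%:R < d * t%:R by rewrite [d * _]mulrC -ltr_pdivrMr.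
(* The grid point of index [h] may equal [r], so the strict lower bound uses [h - 1]. *)
pose h := Num.floor (r * t%:R / N%:R).
have rtN : r * t%:R / N%:R \is Num.real by rewrite !(realM, realV) ?realn.
have := real_floor_itv rtN; rewrite -/h => /andP[].
rewrite ler_pdivlMr // ltr_pdivrMr // rmorphD /= => h_le h_gt.
exists (h - 1), (h + 1), t; split=> //.
- by rewrite /t coprime_sym -addn1 /coprime gcdnMDl gcdn1.
- rewrite ltr_pdivrMr // ltr_pdivlMr // !(rmorphM, rmorphB) /=; apply/andP; split.
    have -> : (r - d) * t%:R = r * t%:R - d * t%:R by ring.
    have -> : N%:~R * (h%:~R - 1) = (h%:~R + 1) * N%:R - 2 * N%:R :> algC by ring.
    exact: ltrB.
  apply: lt_le_trans h_le; rewrite mulrC ltr_pM2r // ltrBlDr ltrDl //.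
- rewrite ltr_pdivrMr // ltr_pdivlMr // !(rmorphM, rmorphD) /=; apply/andP; split.
    by rewrite [_%:~R * _]mulrC.
  have -> : (r + d) * t%:R = r * t%:R + d * t%:R by ring.
  have -> : N%:~R * (h%:~R + 1) = h%:~R * N%:R + N%:R :> algC by ring.
  apply: ler_ltD => //; apply: lt_trans lt_dt.
  by rewrite mulr_natl mulr2n ltrDl.
Qed.

(** Opposite signs would give [|y1 - y2| = |y1| + |y2| > |c|], while both points lie within
    [|c| / 2] of [c]. The centre [c] may be any complex number: it will be [g.[r]], whose reality is
    not known. *)
Lemma gt0_of_near (c y1 y2 : algC) : y2 \is Num.real ->
  2 * `|y1 - c| < `|c| -> 2 * `|y2 - c| < `|c| -> 0 < y1 -> 0 < y2.
Proof.
move=> y2_real y1c y2c y1_gt0; rewrite real_ltNge //; apply/negP => y2_le0.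
have big y : 2 * `|y - c| < `|c| -> `|c| < 2 * `|y|.
  move=> yc; rewrite -(ltrD2l `|c|); apply: le_lt_trans (_ : _ <= 2 * `|y - c| + 2 * `|y|) _.
    rewrite -mulrDr -[X in X + X <= _]mul1r -mulrDl ler_wpM2l ?addr_ge0 //.
    by have := ler_normB y (y - c); rewrite subKr addrC.
  by rewrite ltrD2r.
have := ltrD (big _ y1c) (big _ y2c); rewrite -mulrDr (gtr0_norm y1_gt0) (ler0_norm y2_le0).
have -> : y1 - y2 = `|y1 - c - (y2 - c)|.
  have -> : y1 - c - (y2 - c) = y1 - y2 by ring.
  by rewrite ger0_norm // subr_ge0 (le_trans y2_le0 (ltW y1_gt0)).
move=> lt1; have := ler_normB (y1 - c) (y2 - c).
rewrite -(ler_pM2l (_ : 0 < 2)) // mulrDr => le2.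
by have := lt_trans (lt_le_trans lt1 le2) (ltrD y1c y2c); rewrite ltxx.
Qed.

(** Close to [r] the values of [g] at admissible points keep one sign while [x - r] changes sign, so
    a suitable side of [r] gives the required sign. *)
Lemma sign_change_near_root (N : nat) (r : algC) (g : {poly algC}) (b : bool) :
  (0 < N)%N -> r \is Num.real -> g.[r] != 0 ->
  (forall (s : int) (t : nat), let x : algC := s%:~R / t%:R in
     (0 < t)%N -> (x - r) * g.[x] \is Num.real) ->
  exists (s : int) (t : nat), [/\ (0 < t)%N, coprime t N, (N %| s)%Z &
    let x : algC := s%:~R / t%:R in (-1) ^+ b * ((x - r) * g.[x]) < 0].
Proof.
move=> N_gt0 r_real nz_gr real_g.
have [q Dq] : exists q, g = g.[r]%:P + q * ('X - r%:P).
  have /factor_theorem[q Dq] : root (g - g.[r]%:P) r.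
    by rewrite /root !hornerE subrr.
  by exists q; rewrite -Dq addrC subrK.
have [B qB] := poly_disk_bound q (`|r| + 1).
(* [M] bounds [2 * |q|] on the disk and [M * d = |g.[r]|], an explicit form of continuity. The
   summand [|g.[r]|] in [M] forces [d <= 1], which keeps [x] in the disk. *)
pose M := 2 * (`|B| + 1 + `|g.[r]|); pose d := `|g.[r]| / M.
have gr_gt0 : 0 < `|g.[r]| by rewrite normr_gt0.
have M_gt0 : 0 < M by rewrite mulr_gt0 // addr_gt0 // ltr_wpDl.
have d_gt0 : 0 < d by rewrite divr_gt0.
have d_le1 : d <= 1.
  rewrite ler_pdivrMr // mul1r /M mulrDr.
  by rewrite ler_wpDl ?mulr_ge0 ?addr_ge0 // mulr_natl mulr2n lerDl.
have g_near x : `|x - r| < d -> 2 * `|g.[x] - g.[r]| < `|g.[r]|.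
  move=> xr_d; rewrite {1}Dq !hornerE addrC addKr normrM.
  have xB : `|q.[x]| <= `|B| + 1 + `|g.[r]|.
    have: `|q.[x]| <= B.
      apply: qB; rewrite -[x](subrK r) addrC.
      by rewrite (le_trans (ler_normD _ _)) // lerD2l (le_trans (ltW xr_d)).
    move=> qxB; have B_ge0 := le_trans (normr_ge0 _) qxB.
    by rewrite (le_trans qxB) // (ger0_norm B_ge0) -addrA lerDl addr_ge0.
  have -> : `|g.[r]| = M * d by rewrite /d mulrC divfK ?gt_eqF.
  apply: le_lt_trans (_ : _ <= M * `|x - r|) _; last by rewrite ltr_pM2l.
  by rewrite mulrA ler_wpM2r // ler_wpM2l.
have [s1 [s2 [t [t_gt0 co_tN /andP[r1 x1r] /andP[rx2 r2]]]]] :=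
  real_rational_approx N_gt0 r_real d_gt0.
pose x (s : int) : algC := (N%:Z * s)%:~R / t%:R.
rewrite -/(x s1) in r1 x1r; rewrite -/(x s2) in r2 rx2.
have xr_real s : x s - r \is Num.real.
  by rewrite rpredB // rpredM ?realz ?realV ?realn.
have x1r0 : x s1 - r < 0 by rewrite subr_lt0.
have x2r0 : 0 < x s2 - r by rewrite subr_gt0.
have g_real s : x s - r != 0 -> g.[x s] \is Num.real.
  move=> nz; rewrite -[g.[_]](mulKf nz) realM ?realV //.
  exact: real_g.
have g1_real : g.[x s1] \is Num.real by rewrite g_real ?lt_eqF.
have g2_real : g.[x s2] \is Num.real by rewrite g_real ?gt_eqF.
have near1 : 2 * `|g.[x s1] - g.[r]| < `|g.[r]|.
  by apply: g_near; rewrite ltr0_norm // opprB ltrBlDr addrC -ltrBlDr.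
have near2 : 2 * `|g.[x s2] - g.[r]| < `|g.[r]|.
  by apply: g_near; rewrite gtr0_norm // ltrBlDl.
have dvN s : (N %| N%:Z * s)%Z by rewrite dvdz_mulr.
have nz_g1 : g.[x s1] != 0.
  by apply: contraTneq near1 => ->; rewrite sub0r normrN le_gtF ?ler_peMl ?ler1n.
have [g1_gt0 | g1_lt0 | g1_0] := real_ltgt0P g1_real.
- have g2_gt0 := gt0_of_near g2_real near1 near2 g1_gt0.
  case: b; [exists (N%:Z * s2), t | exists (N%:Z * s1), t]; split; rewrite //= -/(x _).
    by rewrite mulN1r oppr_lt0 mulr_gt0.
  by rewrite mul1r pmulr_llt0.
- have g2_lt0 : g.[x s2] < 0.
    have near y : 2 * `|y - g.[r]| < `|g.[r]| -> 2 * `|- y - (- g.[r])| < `|- g.[r]|.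
      by rewrite -opprD !normrN.
    have := gt0_of_near _ (near _ near1) (near _ near2).
    by rewrite !oppr_gt0 realN; apply.
  case: b; [exists (N%:Z * s1), t | exists (N%:Z * s2), t]; split; rewrite //= -/(x _).
    by rewrite mulN1r oppr_lt0 nmulr_lgt0.
  by rewrite mul1r nmulr_llt0.
- by rewrite g1_0 eqxx in nz_g1.
Qed.

(** * Cyclotomic roots and the Frobenius map in characteristic [p] *)

(** If [z] had a smaller order [d], it would be a common root of ['X^d - 1] and ['Phi_n], which are
    coprime factors of the separable polynomial ['X^n - 1]. *)
Lemma root_Cyclotomic_prim (F : fieldType) n (z : F) : (0 < n)%N -> n%:R != 0 :> F ->
  root (map_poly intr 'Phi_n) z -> n.-primitive_root z.
Proof.
move=> n_gt0 nz_n rz.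
pose phi d : {poly F} := map_poly intr 'Phi_d.
have prod_phi d : (0 < d)%N -> \prod_(e <- divisors d) phi e = 'X^d - 1.
  move=> d_gt0; rewrite -rmorph_prod prod_Cyclotomic //.
  by rewrite rmorphB rmorph1 /= map_polyXn.
have phi_dvd d e : (0 < d)%N -> (e %| d)%N -> phi e %| 'X^d - 1.
  move=> d_gt0 dv_e; rewrite -prod_phi // (big_rem e) -?dvdn_divisors //=.
  exact: dvdp_mulIl.
have zn1 : z ^+ n = 1.
  have : root ('X^n - 1) z := root_dvdp (phi_dvd n n n_gt0 (dvdnn n)) rz.
  by rewrite /root !hornerE subr_eq0 => /eqP.
have [d prim_d dv_d] := prim_order_exists n_gt0 zn1.
have [<- // | ne_dn] := eqVneq d n.
have d_gt0 := prim_order_gt0 prim_d.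
have : separable_poly ('X^n - 1 : {poly F}) := separable_Xn_sub_1 nz_n.
rewrite -prod_phi // (bigID (fun e => e %| d)%N) /= separable_mul => /and3P[_ _].
have -> : \prod_(e <- divisors n | (e %| d)%N) phi e = 'X^d - 1.
  rewrite -prod_phi // -big_filter; apply: perm_big; apply: uniq_perm => [||e].
  - by rewrite filter_uniq ?divisors_uniq.
  - exact: divisors_uniq.
  rewrite mem_filter -!dvdn_divisors //.
  by apply: andb_idr => dv_e; apply: dvdn_trans dv_e dv_d.
move/coprimep_root => /(_ z).
rewrite /root !hornerE (prim_expr_order prim_d) subrr => /(_ (eqxx _)).
rewrite (big_rem n) /=; last by rewrite -dvdn_divisors.
have -> : ~~ (n %| d)%N.
  by apply: contra ne_dn => dv_n; rewrite eqn_dvd dv_d.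
by rewrite hornerM (rootP rz) mul0r eqxx.
Qed.

Lemma ext_sqrt_N1 p : prime p -> exists (L : fieldType) (i : L), p \in [pchar L] /\ i ^+ 2 = -1.
Proof.
move=> p_pr; have nz : ('X^2 + 1%:P : {poly 'F_p}) != 0.
  by rewrite -size_poly_eq0 size_XnaddC.
have [L [rs Drs _]] := FinSplittingFieldFor nz.
have := size_XnaddC (1 : 'F_p) (isT : (0 < 2)%N).
rewrite -(size_map_poly (in_alg L)) (eqp_size Drs) size_prod_XsubC => -[szrs].
have : rs`_0 \in rs by rewrite mem_nth ?szrs.
rewrite -root_prod_XsubC -(eqp_root Drs) => /rootP.
rewrite rmorphD rmorph1 /= map_polyXn !hornerE => /eqP.
rewrite addr_eq0 => /eqP r2.
exists L, rs`_0; split=> //.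
by rewrite (rmorph_pchar (in_alg L)) // pchar_Fp.
Qed.

Lemma dvdn_succ_of_hform0 N p (s t : int) (L : fieldType) (i : L) :
  (0 < N)%N -> p \in [pchar L] -> (p %% 4 = 3)%N -> i ^+ 2 = -1 -> ~~ (p %| N)%N ->
  ~~ ((p %| s)%Z && (p %| t)%Z) ->
  hform 'Phi_N (t%:~R + s%:~R * i) (t%:~R - s%:~R * i) = 0 :> L -> (N %| p.+1)%N.
Proof.
move=> N_gt0 pL p3 i2 p'N p'st h0.
have p_pr := pcharf_prime pL.
set al := (_ + _) in h0; set be := (_ - _) in h0.
have intL (m : int) : (m%:~R == 0 :> L) = (p %| m)%Z.
  case: m => m; rewrite ?NegzE ?rmorphN ?oppr_eq0 /= -(dvdn_pcharf pL) //.
have nz_i : i != 0.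
  by apply: contra_eq_neq i2 => ->; rewrite expr0n /= eq_sym oppr_eq0 oner_eq0.
have nz_2 : 2 != 0 :> L.
  rewrite -(dvdn_pcharf pL) dvdn_prime2 //.
  by apply: contra_eq_neq p3 => ->.
(* If [be] vanished, the form would reduce to a power of [al]; then [al] vanishes too, and [p]
   divides both [s] and [t]. *)
have nz_be : be != 0.
  apply: contra p'st => /eqP be0.
  move: h0; rewrite be0 hform_monic0 ?Cyclotomic_monic // => /eqP.
  rewrite expf_eq0 => /andP[_ /eqP al0].
  have t2 : 2 * t%:~R = 0 :> L by rewrite -[RHS]addr0 -{1}al0 -be0 /al /be; ring.
  have {t2} t0 : t%:~R = 0 :> L by move/eqP: t2; rewrite mulf_eq0 (negPf nz_2) => /eqP.
  have /eqP : s%:~R * i = 0 by move: al0; rewrite /al t0 add0r.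
  by rewrite mulf_eq0 (negPf nz_i) orbF -!intL t0 eqxx andbT.
pose z := al / be.
have /root_Cyclotomic_prim prim_z : root (map_poly intr 'Phi_N) z.
  move/eqP: h0; rewrite hform_horner // mulf_eq0 expf_eq0 (negPf nz_be) andbF /=.
  exact.
have {}prim_z : N.-primitive_root z by rewrite prim_z // -(dvdn_pcharf pL).
(* Since [p] is 3 modulo 4, Frobenius acts on [i] as conjugation. *)
have ip : i ^+ p = - i.
  rewrite (divn_eq p 4) p3 exprD mulnC exprM.
  have -> : i ^+ 4 = 1 by rewrite -[4%N]/(2 * 2)%N exprM i2 sqrrN expr1n.
  by rewrite expr1n mul1r exprSr i2 mulN1r.
have frob := pFrobenius_autE pL.
have frobZ (m : int) : pFrobenius_aut pL m%:~R = m%:~R by rewrite rmorph_int.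
have al_p : al ^+ p = be.
  by rewrite -frob rmorphD rmorphM /= !frobZ frob ip mulrN.
have be_p : be ^+ p = al.
  by rewrite -frob rmorphB rmorphM /= !frobZ frob ip mulrN opprK.
rewrite (prim_order_dvd prim_z) exprSr expr_div_n al_p be_p /z.
have nz_al : al != 0 by rewrite -be_p expf_neq0.
by rewrite mulrA divfK ?divff.
Qed.

(** * Reality and sign of the cyclotomic form over [algC] *)

Lemma totient_card N : totient N = #|[pred k : 'I_N | coprime k N]|.
Proof.
rewrite totient_count_coprime -big_mkcond big_mkord -sum1_card.
by apply: eq_bigl => k; rewrite coprime_sym.
Qed.

Lemma gauss_neq0 (s : int) (t : nat) : (0 < t)%N ->
  t%:R + s%:~R * 'i != 0 :> algC.
Proof.
move=> t_gt0; have ReV : 'Re (t%:R + s%:~R * 'i : algC) = t%:R.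
  by rewrite mulrC Re_rect ?realn ?realz.
apply: contraTneq t_gt0 => V0; move: ReV; rewrite V0 raddf0 => /esym/eqP.
by rewrite pnatr_eq0 -eqn0Ngt.
Qed.

Lemma hform_Cyclotomic_prod N (z a b : algC) : N.-primitive_root z -> b != 0 ->
  hform 'Phi_N a b = \prod_(k < N | coprime k N) (a - z ^+ k * b).
Proof.
move=> prim_z nz_b; rewrite hform_horner // (Cintr_Cyclotomic prim_z).
rewrite size_Cyclotomic horner_prod /=.
rewrite totient_card -prodr_const -big_split; apply: eq_bigr => k _ /=.
by rewrite !hornerE; field.
Qed.

Lemma norm_prim_root (N : nat) (z : algC) : N.-primitive_root z -> `|z| = 1.
Proof.
move=> prim_z; apply/eqP.
by rewrite -(pexpr_eq1 (prim_order_gt0 prim_z)) // -normrX prim_expr_order ?normr1.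
Qed.

(** Conjugating each linear factor multiplies it by [- (z ^+ k)^*], so conjugation multiplies the
    form by a constant [c] independent of the argument. Evaluation at 1, where the form is a nonzero
    integer, gives [c = 1]. *)
Lemma hform_Cyclotomic_real N (s : int) (t : nat) : (0 < N)%N -> (0 < t)%N ->
  ('Phi_N).[1] != 0 ->
  hform 'Phi_N (t%:R + s%:~R * 'i) (t%:R - s%:~R * 'i : algC) \is Num.real.
Proof.
move=> N_gt0 t_gt0 nz1.
have [z prim_z] := C_prim_root_exists N_gt0.
pose c : algC := \prod_(k < N | coprime k N) - (z ^+ k)^*.
have conjV a : a != 0 -> (hform 'Phi_N a a^* )^* = c * hform 'Phi_N a a^*.
  move=> nz_a; rewrite !(hform_Cyclotomic_prod _ prim_z) ?conjC_eq0 //.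
  rewrite rmorph_prod -big_split; apply: eq_bigr => k _ /=.
  rewrite rmorphB rmorphM /= conjCK mulrBr !mulNr opprK addrC mulrA.
  rewrite -normCKC normrX (norm_prim_root prim_z) // !expr1n mul1r.
  by rewrite addrC.
have c1 : c = 1.
  have h1 : hform 'Phi_N 1 1 = ('Phi_N).[1]%:~R :> algC.
    rewrite hform_horner ?oner_neq0 // expr1n mul1r divr1.
    by rewrite -(rmorph1 (intr : int -> algC)) horner_map.
  have := conjV 1 (oner_neq0 _); rewrite conjC1 h1 conj_intr ?intr_int // => /esym/eqP.
  by rewrite -[X in _ == X]mul1r (inj_eq (mulIf _)) ?intr_eq0 // => /eqP.
set al := _ + _; have Dbe : t%:R - s%:~R * 'i = al^*.
  by rewrite rmorphD rmorphM /= conjCi !conj_intr ?intr_int ?rpred_nat // mulrN.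
have nz_al : al != 0 := gauss_neq0 s t_gt0.
by rewrite Dbe CrealE conjV // c1 mul1r.
Qed.

Lemma hform_Cyclotomic_sign N (b : bool) : (2 < N)%N -> ('Phi_N).[1] != 0 ->
  exists (s : int) (t : nat),
    [/\ (0 < t)%N, coprime t N, coprime `|s| t, (N %| s)%Z &
      (-1) ^+ b * hform 'Phi_N (t%:R + s%:~R * 'i) (t%:R - s%:~R * 'i : algC) < 0].
Proof.
move=> N_gt2 nz1; have N_gt0 : (0 < N)%N by apply: leq_trans N_gt2.
have [z prim_z] := C_prim_root_exists N_gt0.
(* The form divided by [t ^+ totient N], as a function of [x = s / t]; its factor at [k = 1]
   vanishes at the real point [r] below. *)
pose F (x : algC) := \prod_(k < N | coprime k N) ((1 - z ^+ k) + 'i * (1 + z ^+ k) * x).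
have nz_be (s : int) (t : nat) : (0 < t)%N -> t%:R - s%:~R * 'i != 0 :> algC.
  by move=> t_gt0; rewrite -mulNr -rmorphN gauss_neq0.
have hF (s : int) (t : nat) : (0 < t)%N ->
  hform 'Phi_N (t%:R + s%:~R * 'i) (t%:R - s%:~R * 'i : algC)
    = t%:R ^+ totient N * F (s%:~R / t%:R).
  move=> t_gt0; have nz_t : t%:R != 0 :> algC by rewrite pnatr_eq0 -lt0n.
  rewrite (hform_Cyclotomic_prod _ prim_z) ?nz_be // /F.
  rewrite totient_card -prodr_const -big_split; apply: eq_bigr => k _ /=.
  by field.
have z_neqN1 k : coprime k N -> 1 + z ^+ k != 0.
  rewrite -(prim_root_exp_coprime _ prim_z) => prim_zk; rewrite addrC addr_eq0.
  apply: contraTneq N_gt2 => zk; rewrite -leqNgt dvdn_leq //.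
  by rewrite (prim_order_dvd prim_zk) zk sqrrN expr1n.
have N_gt1 : (1 < N)%N by apply: leq_trans N_gt2.
pose k1 := Ordinal N_gt1.
(* [(1 + 'i * r) / (1 - 'i * r) = z] *)
pose r : algC := 'i * (1 - z) / (1 + z).
have nz_z1 : 1 + z != 0 by rewrite -[z]expr1 z_neqN1 ?coprime1n.
have nz_z : z != 0 by rewrite -normr_eq0 (norm_prim_root prim_z) oner_neq0.
have i2 : 'i * 'i = -1 :> algC by rewrite -expr2 sqrCi.
have r_real : r \is Num.real.
  have zV : z^* = z^-1 by rewrite invC_norm (norm_prim_root prim_z) expr1n invr1 mul1r.
  rewrite CrealE /r !(rmorphM, rmorphB, rmorphD, fmorphV, rmorph1) /= conjCi zV.
  have nz_z2 : z + 1 != 0 by rewrite addrC.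
  by apply/eqP; field; rewrite ?nz_z ?nz_z1 ?nz_z2.
pose g : {poly algC} := ('i * (1 + z))%:P *
  \prod_(k < N | coprime k N && (k != k1)) ((1 - z ^+ k)%:P + ('i * (1 + z ^+ k)) *: 'X).
have nzi : 'i != 0 :> algC by exact: neq0Ci.
have Fg x : F x = (x - r) * g.[x].
  rewrite /F /g (bigD1 k1) ?coprime1n //= expr1 hornerM hornerC horner_prod mulrA.
  congr (_ * _); last by apply: eq_bigr => k _; rewrite !hornerE.
  rewrite mulrBl (_ : r * _ = 'i * 'i * (1 - z)); last by rewrite /r; field.
  by rewrite i2; ring.
(* The root [r] is simple: at [r] the factor of index [k] is a nonzero multiple of [z - z ^+ k]. *)
have nz_gr : g.[r] != 0.
  rewrite /g hornerM hornerC mulf_neq0 ?mulf_neq0 // horner_prod.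
  apply/prodf_neq0 => k /andP[co_k ne_k]; rewrite hornerD hornerC hornerZ hornerX.
  have -> : (1 - z ^+ k) + 'i * (1 + z ^+ k) * r = 2 * (z - z ^+ k) / (1 + z).
    rewrite /r [X in _ + X](_ : _ = 'i * 'i * (1 + z ^+ k) * (1 - z) / (1 + z)); last by field.
    by rewrite i2; field.
  rewrite mulf_neq0 ?invr_eq0 // mulf_neq0 ?pnatr_eq0 // subr_eq0.
  rewrite -{1}[z]expr1 (eq_prim_root_expr prim_z).
  rewrite !modn_small // eq_sym; exact: ne_k.
have real_F (s : int) (t : nat) : let x : algC := s%:~R / t%:R in
     (0 < t)%N -> (x - r) * g.[x] \is Num.real.
  move=> x t_gt0; rewrite -Fg; have := hform_Cyclotomic_real s N_gt0 t_gt0 nz1.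
  rewrite hF //; have nz_t : t%:R ^+ totient N != 0 :> algC.
    by rewrite expf_neq0 ?pnatr_eq0 -?lt0n.
  by move=> V_real; rewrite -[F x](mulKf nz_t) realM ?realV ?realX ?realn.
have [s [t [t_gt0 co_tN dvNs]]] := sign_change_near_root b N_gt0 r_real nz_gr real_F.
rewrite /= -Fg => ltF.
(* Passing to lowest terms preserves the ratio, hence the sign. It also preserves divisibility by
   [N], since [d] divides [t] and so is coprime to [N]. *)
pose d := gcdn `|s| t; have d_gt0 : (0 < d)%N by rewrite gcdn_gt0 t_gt0 orbT.
have /dvdzP[s' Ds] : (d %| s)%Z by rewrite dvdzE /= dvdn_gcdl.
have /dvdnP[t' Dt] : (d %| t)%N by rewrite dvdn_gcdr.
have t'_gt0 : (0 < t')%N by move: t_gt0; rewrite Dt muln_gt0 => /andP[].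
exists s', t'; split=> //.
- by apply: coprime_dvdl co_tN; rewrite Dt dvdn_mulr.
- rewrite /coprime -(eqn_pmul2r d_gt0) mul1n muln_gcdl -Dt.
  by have := congr1 absz Ds; rewrite abszM /= => <-.
- move: dvNs; rewrite Ds dvdzE abszM /= Gauss_dvdl //.
  by rewrite coprime_sym (coprime_dvdl _ co_tN) // Dt dvdn_mull.
rewrite hF // mulrCA pmulr_rlt0 ?exprn_gt0 ?ltr0n //.
suff <- : s%:~R / t%:R = s'%:~R / t'%:R :> algC by [].
have nz_d : d%:R != 0 :> algC by rewrite pnatr_eq0 -lt0n.
have nz_t' : t'%:R != 0 :> algC by rewrite pnatr_eq0 -lt0n.
by rewrite Ds Dt natrM rmorphM /=; field; rewrite nz_d nz_t'.
Qed.

(** * A prime congruent to -1 modulo [N] *)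

Lemma prime_opp1_mod u v : coprime u v -> (1 < u)%N -> (1 < v)%N -> (4 %| u * v)%N ->
  exists2 p, prime p & (u * v %| p.+1)%N.
Proof.
move=> co_uv u_gt1 v_gt1 dv4; set N := (u * v)%N in dv4 *.
have [b Phi1] := Cyclotomic_coprime_horner1 co_uv u_gt1 v_gt1; rewrite -/N in Phi1.
have N_gt2 : (2 < N)%N by rewrite /N; nia.
have N_gt0 : (0 < N)%N by apply: leq_trans N_gt2.
have nz1 : ('Phi_N).[1] != 0 by rewrite Phi1 signr_eq0.
have [s [t [t_gt0 co_tN co_st dvNs]]] := hform_Cyclotomic_sign b N_gt2 nz1.
have [A [B hAB]] := hform_gauss 'Phi_N s t.
rewrite size_Cyclotomic Phi1 /= in hAB.
have := hform_Cyclotomic_real s N_gt0 t_gt0 nz1.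
rewrite (hAB algC 'i (sqrCi _)).
set m := _ + s * A in hAB *; have m_real : m%:~R \is @Num.real algC by apply: realz.
move=> V_real.
(* Reality over [algC] kills the integer [s * B]; the form therefore equals the integer [m] in
   characteristic [p] as well. *)
have sB0 : s * B = 0.
  have : (s * B)%:~R * 'i \is @Num.real algC by rewrite -(addKr m%:~R (_ * 'i)) realD ?realN.
  rewrite CrealE rmorphM /= conjCi conj_intr ?intr_int // mulrN eqNr mulf_eq0.
  by rewrite (negPf (neq0Ci _)) orbF intr_eq0 => /eqP.
rewrite sB0 mul0r addr0 -(rmorph_sign (intr : int -> algC)) -rmorphM /= ltrz0 => m_lt0.
pose n := `|m|%N; pose T := (t ^ totient N)%N.
have Dn : n%:Z = - ((-1) ^+ b * m).
  by rewrite -(ltz0_abs m_lt0) abszMsign.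
(* [m] is [(-1) ^+ b * T] modulo [s], and [b] was chosen so that [m] has the opposite sign; hence
   [n = |m|] is [- T] modulo [N]. *)
have dvN : (N %| n + T)%N.
  have -> : (N %| n + T)%N = (N %| n%:Z + T%:Z)%Z by [].
  have -> : n%:Z + T%:Z = - ((-1) ^+ b * A) * s.
    have -> : T%:Z = t%:Z ^+ totient N by rewrite -[T%:Z]natz -[t%:Z]natz natrX.
    by rewrite Dn /m mulrDr mulrA -expr2 sqrr_sign mul1r; ring.
  by rewrite dvdz_mull.
have n3 : (n %% 4 = 3)%N.
  have odd_t : odd t.
    by rewrite -coprimen2 (coprime_dvdr _ co_tN) // (dvdn_trans _ dv4).
  have T1 : (T %% 4 = 1)%N.
    have /even_halfK : ~~ odd (totient N) by rewrite totient_even.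
    rewrite /T -muln2 mulnC => <-; rewrite expnM -modnXm.
    suff -> : (t ^ 2 %% 4 = 1)%N by rewrite exp1n.
    rewrite -modnXm; have := ltn_pmod t (isT : (0 < 4)%N).
    have : odd (t %% 4) by rewrite (@odd_mod t 4).
    by case: (t %% 4)%N => [|[|[|[|]]]].
  have := dvdn_trans dv4 dvN; lia.
have [p p_n /andP[p_pr /eqP p3]] := modn4_prime_divisor n3.
exists p => //.
(* A common prime divisor of [n] and [N] would divide [T], hence [t], which is coprime to [N]. *)
have p'N : ~~ (p %| N)%N.
  apply/negP => p_N; have : (p %| T)%N by rewrite -(dvdn_addr _ p_n) (dvdn_trans p_N).
  rewrite Euclid_dvdX // => /andP[p_t _].
  have : (p %| gcdn t N)%N by rewrite dvdn_gcd p_t.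
  by rewrite (eqnP co_tN) dvdn1 => /eqP p1; rewrite p1 in p_pr.
have [L [i [pL i2]]] := ext_sqrt_N1 p_pr.
apply: (dvdn_succ_of_hform0 (s := s) (t := t) N_gt0 pL p3 i2 p'N).
  rewrite !dvdzE /= -dvdn_gcd (eqnP co_st) dvdn1.
  by apply: contraTneq p_pr => ->.
rewrite hAB // sB0 mul0r addr0.
have /dvdnP[e Dm] := p_n.
rewrite [m]intEsign -/n Dm rmorphMsign /= PoszM rmorphM /=.
by have -> : p%:~R = 0 :> L := pcharf0 pL; rewrite mulr0 mulr0.
Qed.

(* Infinitely many solutions *)
Local Close Scope ring_scope.

(** The coprime factors are the 2-part and the odd part of [12 * k]. The factor 12 supplies
    divisibility by 4 and keeps the odd part above 1 even when [k] is a power of 2. *)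
Lemma exists_prime_opp1_mod_double k :
  0 < k -> exists2 p, prime p & k.*2 %| p.+1.
Proof.
move=> k_gt0; have n_gt0 : 0 < 12 * k by rewrite muln_gt0.
have D := partnC 2 n_gt0.
have gt1 (q : nat) (pi : nat_pred) :
    prime q -> q \in pi -> q %| 12 -> 1 < (12 * k)`_pi.
  move=> q_pr q_pi q12; apply: leq_trans (prime_gt1 q_pr) _; apply: dvdn_leq => //.
  by rewrite -[q](@part_pnat_id pi) ?partn_dvd ?pnatE // dvdn_mulr.
have [|||| p p_pr] := @prime_opp1_mod (12 * k)`_2 (12 * k)`_2^'.
- exact: coprime_partC.
- exact: (gt1 2).
- exact: (gt1 3).
- by rewrite D dvdn_mulr.
rewrite D => dvp; exists p => //; apply: dvdn_trans dvp.
by rewrite -muln2 mulnC dvdn_mul.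
Qed.

Theorem theorem2 (k : nat) (hk : (2 <= k)%N) :
  infinite_set [set n : nat | (0 < n)%N /\
    (n%:R / (pseudo_smarandache n)%:R = k%:R :> rat)%R]%classic.
Proof.
have [p p_pr dv_2k] := exists_prime_opp1_mod_double (ltnW hk).
(* Odd exponents keep the power of [p] congruent to -1 modulo [k.*2]. *)
pose h e := k * p ^ e.*2.+1.
set S := [set n | _]%classic => finS; apply: infinite_nat.
have inj_h : {in (h @^-1` S)%classic &, injective h}.
  move=> e1 e2 _ _ /eqP; rewrite eqn_pmul2l ?(ltnW hk) //.
  by rewrite eqn_exp2l ?prime_gt1 // eqSS => /eqP/double_inj.
suff <- : (h @^-1` S = setT)%classic by apply: finite_preimage inj_h finS.
apply/seteqP; split=> // e _; rewrite /S /=.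
have pe_gt0 : 0 < p ^ e.*2.+1 by rewrite expn_gt0 prime_gt0.
split; first by rewrite muln_gt0 pe_gt0 ltnW.
rewrite pseudo_smarandache_prime_power //.
  by rewrite natrM mulfK // pnatr_eq0 -lt0n.
apply: dvdn_trans dv_2k _.
elim: e {pe_gt0} => // e IH.
(* Raising the exponent by 2 adds a multiple of [p ^ 2 - 1], hence of [p.+1]. *)
have -> : (p ^ e.+1.*2.+1).+1 = p ^ e.*2.+1 * p.-1 * p.+1 + (p ^ e.*2.+1).+1.
  rewrite doubleS 2!expnS; move: (p ^ _) => x.
  by case: (p) (prime_gt0 p_pr) => //= r _; ring.
by rewrite dvdn_add // dvdn_mull.
Qed.
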